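(* There is a randomized algorithm that, given a PL+C model (utilities $u_i$ and consideration probabilities $p_i$ for all $i\in\mathcal U$, with $|\mathcal U|=n$ and ranking length $k$), a length-$k$ ranking $r$, an error tolerance $\epsilon>0$ and a failure probability $\delta\in(0,1)$, outputs an estimate $\hat R$ such that, with probability at least $1-\delta$, both $|\hat R-\Pr_{PLC}(r)|<\epsilon$ and the running time is $O\!\left(kn\log(1/\delta)/(z_{k,p}\epsilon^2)\right)$.
   Context: PL+C model: universe $\mathcal U=\{1,\dots,n\}$, fixed ranking length $k\le n$. Each item $i$ has a utility $u_i$ and a consideration probability $p_i\in(0,1]$. $z_{k,p}=\sum_{C\subseteq\mathcal U,|C|\ge k}\prod_{h\in C}p_h\prod_{h\notin C}(1-p_h)$ is the probability that a random set including each item independently with probability $p_h$ has size at least $k$. A consideration set $C$ is drawn from this distribution conditioned on $|C|\ge k$, i.e. $\Pr_C(C)=\frac{1}{z_{k,p}}\prod_{h\in C}p_h\prod_{h\notin C}(1-p_h)$ for $|C|\ge k$ and $0$ otherwise. Given $C$, $\Pr_{PL}(r\mid C)=\prod_{t=1}^k \frac{\exp(u_{r_t})}{\sum_{h\in C\setminus\{r_1,\dots,r_{t-1}\}}\exp(u_h)}$ if all $r_t\in C$, else $0$, and $\Pr_{PLC}(r)=\sum_C\Pr_C(C)\Pr_{PL}(r\mid C)$. Arithmetic operations and sampling a Bernoulli variable are unit cost.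
   Formalization: The running-time bound is proved as O(1 + kn(1+log(1/δ))/(z_{k,p}ε²)), for k ≥ 1: the bound as written tends to 0 as δ→1 or ε→∞, which no algorithm can meet; for δ bounded away from 1 and ε ≤ 1 the two agree up to a constant. *)

(* Defs.v *)
From mathcomp Require Import all_boot all_order all_algebra.
From mathcomp Require Import reals sequences exp.
Set Implicit Arguments. Unset Strict Implicit. Unset Printing Implicit Defensive.
Import Order.TTheory GRing.Theory Num.Theory.
Local Open Scope ring_scope.

Definition cweight (R : realType) (n : nat) (p : 'I_n -> R) (C : {set 'I_n}) : R :=
  (\prod_(h in C) p h) * \prod_(h in ~: C) (1 - p h).

Definition zkp (R : realType) (n k : nat) (p : 'I_n -> R) : R :=
  \sum_(C : {set 'I_n} | (k <= #|C|)%N) cweight p C.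

Definition PrC (R : realType) (n k : nat) (p : 'I_n -> R) (C : {set 'I_n}) : R :=
  if (k <= #|C|)%N then cweight p C / zkp k p else 0.

Definition PrPL (R : realType) (n k : nat) (u : 'I_n -> R) (r : k.-tuple 'I_n)
    (C : {set 'I_n}) : R :=
  if [forall t : 'I_k, tnth r t \in C] then
    \prod_(t < k)
      (expR (u (tnth r t)) /
       \sum_(h in C :\: [set tnth r s | s : 'I_k & (s < t)%N]) expR (u h))
  else 0.

Definition PrPLC (R : realType) (n k : nat) (u p : 'I_n -> R) (r : k.-tuple 'I_n) : R :=
  \sum_(C : {set 'I_n}) PrC k p C * PrPL u r C.

(*  Randomized real-RAM model: unit-cost arithmetic (incl. exp),       *)
(*  comparisons/branching, indirect addressing, unit-cost Bernoulli.   *)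
(*  Two memories: natural-number registers Ir (for counters/indices)   *)
(*  and real registers Mr.  No real->integer conversion (no floor).    *)
(*  Input (read-only): n in Ir 0, k in Ir 1, eps in Mr 0, delta in     *)
(*  Mr 1; u_i, p_i, r_t accessed by instructions ReadU/ReadP/ReadR.    *)
(*  Output: content of Mr 0 on halting.  Running time = number of      *)
(*  executed instructions.                                             *)

Inductive instr : Type :=
| INat   (d m : nat)
| IAdd   (d a b : nat)
| ISub   (d a b : nat)        (* Ir[d] := Ir[a] - Ir[b] (truncated)       *)
| ILoad  (d a : nat)
| IStore (a s : nat)
| RNat   (d m : nat)
| RofI   (d a : nat)
| RAdd   (d a b : nat)
| RSub   (d a b : nat)
| RMul   (d a b : nat)
| RDiv   (d a b : nat)        (* Mr[d] := Mr[a] / Mr[b]  (x/0 = 0)        *)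
| RExp   (d a : nat)
| RLoad  (d a : nat)
| RStore (a s : nat)
| ReadU  (d a : nat)          (* Mr[d] := u_{Ir[a]}   (0 if out of range) *)
| ReadP  (d a : nat)          (* Mr[d] := p_{Ir[a]}   (0 if out of range) *)
| ReadR  (d a : nat)          (* Ir[d] := r_{Ir[a]}   (0 if out of range) *)
| JLtI   (a b tgt : nat)
| JLtR   (a b tgt : nat)
| Jmp    (tgt : nat)
| Flip   (d a : nat)          (* Ir[d] := 1 w.p. Mr[a] (clamped to [0,1]),
                                 else 0                                   *)
| Halt.

Record state (R : Type) := State { pc : nat; Ir : nat -> nat; Mr : nat -> R }.

Definition upd (T : Type) (f : nat -> T) (a : nat) (v : T) : nat -> T :=
  fun x => if x == a then v else f x.

Record input (R : Type) := Input {
  in_u : nat -> R; in_p : nat -> R; in_r : nat -> nat }.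

Definition dstep (R : realType) (env : input R) (i : instr) (s : state R) : state R :=
  let: State q IM RM := s in
  let nx := q.+1 in
  match i with
  | INat d m => State nx (upd IM d m) RM
  | IAdd d a b => State nx (upd IM d (IM a + IM b)%N) RM
  | ISub d a b => State nx (upd IM d (IM a - IM b)%N) RM
  | ILoad d a => State nx (upd IM d (IM (IM a))) RM
  | IStore a s0 => State nx (upd IM (IM a) (IM s0)) RM
  | RNat d m => State nx IM (upd RM d m%:R)
  | RofI d a => State nx IM (upd RM d (IM a)%:R)
  | RAdd d a b => State nx IM (upd RM d (RM a + RM b))
  | RSub d a b => State nx IM (upd RM d (RM a - RM b))
  | RMul d a b => State nx IM (upd RM d (RM a * RM b))
  | RDiv d a b => State nx IM (upd RM d (RM a / RM b))
  | RExp d a => State nx IM (upd RM d (expR (RM a)))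
  | RLoad d a => State nx IM (upd RM d (RM (IM a)))
  | RStore a s0 => State nx IM (upd RM (IM a) (RM s0))
  | ReadU d a => State nx IM (upd RM d (in_u env (IM a)))
  | ReadP d a => State nx IM (upd RM d (in_p env (IM a)))
  | ReadR d a => State nx (upd IM d (in_r env (IM a))) RM
  | JLtI a b tgt => State (if (IM a < IM b)%N then tgt else nx) IM RM
  | JLtR a b tgt => State (if RM a < RM b then tgt else nx) IM RM
  | Jmp tgt => State tgt IM RM
  | Flip _ _ => State nx IM RM   (* handled separately *)
  | Halt => State q IM RM        (* handled separately *)
  end.

Definition clamp01 (R : realType) (x : R) : R := Num.min 1 (Num.max 0 x).

Fixpoint succ_prob (R : realType) (P : seq instr) (env : input R) (good : pred R)
    (fuel : nat) (s : state R) : R :=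
  let i := nth Halt P (pc s) in
  match i with
  | Halt => if good (Mr s 0) then 1 else 0
  | _ =>
    match fuel with
    | 0 => 0
    | fuel'.+1 =>
      match i with
      | Flip d a =>
          let q := clamp01 (Mr s a) in
          q * succ_prob P env good fuel' (State (pc s).+1 (upd (Ir s) d 1%N) (Mr s))
          + (1 - q) * succ_prob P env good fuel' (State (pc s).+1 (upd (Ir s) d 0%N) (Mr s))
      | _ => succ_prob P env good fuel' (dstep env i s)
      end
    end
  end.

Definition fun_of_ord (R : realType) (n : nat) (f : 'I_n -> R) : nat -> R :=
  fun i => match @insub nat (fun j => (j < n)%N) 'I_n i with
           | Some j => f j | None => 0 end.

Definition encode (R : realType) (n k : nat) (u p : 'I_n -> R) (r : k.-tuple 'I_n) : input R :=
  Input (fun_of_ord u) (fun_of_ord p) (fun t => nth 0%N (map val r) t).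

Definition init_state (R : realType) (n k : nat) (eps delta : R) : state R :=
  State 0 (upd (upd (fun _ => 0%N) 0 n) 1 k) (upd (upd (fun _ => 0) 0 eps) 1 delta).

(* Main.v *)
Require Import Defs.
From mathcomp Require Import all_boot all_order all_algebra.
From mathcomp Require Import reals sequences exp.
From mathcomp Require Import zify ring lra.
Set Implicit Arguments. Unset Strict Implicit. Unset Printing Implicit Defensive.
Import Order.TTheory GRing.Theory Num.Theory.
Local Open Scope ring_scope.

(** If [eps > 1/2] the answer [1/2] is good enough.  Otherwise no rejection
    sampling is needed: a set containing all [k] ranked items automatically has
    size at least [k], so with [C'] a set of independently chosen unranked items,
      [PrPLC r = (\prod_t p (r t) / z) * E (PrPL r (C' :|: r))],
    where [z = zkp k p] is computed exactly in [O(k n)] by dynamic programming and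
    [\prod_t p (r t) <= z], so that one sample lies in [[0, 1]].  Averaging [m]
    samples, [m] least such that [2 exp (- m eps^2 / 4) <= delta], suffices by a
    Chernoff bound; no logarithm has to be computed. *)

(* Numbers in comments are jump targets.  Integer registers: 2 holds 1, 3 holds
   16, 5 holds 0, and 16+i marks item i as ranked.  Real registers: 2 holds 1,
   16+j is the j-th entry of the dynamic programming table; from 50 on, 5 is
   [\prod_t p (r t) / z], 6 is [2 D ^ i] and 7 is [D = exp (- eps^2 / 4)], 8 and
   9 are the sum and the number i of the samples, 10 is the accumulated weight. *)
Definition plc_prog : seq instr := [::
  INat 2 1; INat 3 16; RNat 2 1; RAdd 3 2 2; RDiv 4 2 3; JLtR 4 0 88;
  IAdd 4 1 5; RNat 5 1;
  (* 8 *) JLtI 5 4 10; Jmp 17;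
  ISub 4 4 2; ReadR 6 4; ReadP 6 6; RMul 5 5 6; IAdd 6 3 6; IStore 6 2; Jmp 8;
  (* 17 *) RStore 3 2; INat 4 0;
  (* 19 *) JLtI 4 0 21; Jmp 38;
  ReadP 6 4; RSub 7 2 6; IAdd 6 1 5;
  (* 24 *) JLtI 5 6 26; Jmp 36;
  IAdd 7 3 6; RLoad 8 7; RMul 8 8 7; ISub 6 6 2; IAdd 8 3 6; RLoad 9 8;
  RMul 9 9 6; RAdd 8 8 9; RStore 7 8; Jmp 24;
  (* 36 *) IAdd 4 4 2; Jmp 19;
  (* 38 *) IAdd 7 3 1; RLoad 6 7; RDiv 5 5 6;
  RMul 7 0 0; RAdd 6 3 3; RDiv 7 7 6; RNat 8 0; RSub 7 8 7; RExp 7 7;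
  RNat 6 2; RNat 8 0; RNat 9 0;
  (* 50 *) JLtR 1 6 52; Jmp 86;
  RMul 6 6 7; RAdd 9 9 2; IAdd 4 0 5; RNat 10 0;
  (* 56 *) JLtI 5 4 58; Jmp 72;
  ISub 4 4 2; ReadP 11 4; IAdd 6 3 4; ILoad 6 6; ISub 6 2 6; RofI 12 6;
  RMul 11 11 12; Flip 6 11;
  ReadU 11 4; RExp 11 11; RofI 12 6; RMul 11 11 12; RAdd 10 10 11; Jmp 56;
  (* 72 *) IAdd 4 1 5; RMul 11 5 2;
  (* 74 *) JLtI 5 4 76; Jmp 84;
  ISub 4 4 2; ReadR 6 4; ReadU 12 6; RExp 12 12; RAdd 10 10 12; RMul 11 11 12;
  RDiv 11 11 10; Jmp 74;
  (* 84 *) RAdd 8 8 11; Jmp 50;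
  (* 86 *) RDiv 0 8 9; Halt;
  (* 88 *) RMul 0 4 2; Halt].

(** * Symbolic execution of the machine *)

Lemma upd_high (T : Type) (f : nat -> T) d v x : (d < 16)%N ->
  upd f d v (16 + x) = f (16 + x)%N.
Proof. by rewrite /upd => h; case: eqP => // e; lia. Qed.

Lemma upd_low (T : Type) (f : nat -> T) d v x : (d < 16)%N ->
  upd f (16 + x) v d = f d.
Proof. by rewrite /upd => h; case: eqP => // e; lia. Qed.

Definition deterministic (i : instr) : bool :=
  match i with Flip _ _ | Halt => false | _ => true end.

Section Machine.
Variables (R : realType) (env : input R) (good : pred R).

(** A run that has not halted when its fuel is spent counts as a failure, so [lb a s L] bounds
    accuracy and running time together. Quantifying over all larger fuels lets bounds be chained
    backwards from [Halt]. *)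
Definition lb (a : nat) (s : state R) (L : R) : Prop :=
  forall T, (a <= T)%N -> L <= succ_prob plc_prog env good T s.

Lemma lb_weaken a b s L : lb a s L -> (a <= b)%N -> lb b s L.
Proof. by move=> h le T le'; apply: h; lia. Qed.

Lemma lb_le a s L L' : lb a s L -> L' <= L -> lb a s L'.
Proof. by move=> h le T le'; apply: le_trans le (h _ le'). Qed.

Lemma lb_step i q IM RM a L : nth Halt plc_prog q = i -> deterministic i ->
  (0 < a)%N -> lb a.-1 (dstep env i (State q IM RM)) L -> lb a (State q IM RM) L.
Proof.
move=> ei di a0 h [|T] le; first by lia.
have {h} : L <= succ_prob plc_prog env good T (dstep env i (State q IM RM)).
  by apply: h; lia.
by rewrite [succ_prob _ _ _ T.+1 _]/= ei; case: i ei di.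
Qed.

Lemma clamp01_id (x : R) : 0 <= x <= 1 -> clamp01 x = x.
Proof. by case/andP => x0 x1; rewrite /clamp01 max_r // min_r. Qed.

Lemma lb_flip d j x q IM RM a L1 L0 : nth Halt plc_prog q = Flip d j ->
  (0 < a)%N -> RM j = x -> 0 <= x <= 1 ->
  lb a.-1 (State q.+1 (upd IM d 1%N) RM) L1 ->
  lb a.-1 (State q.+1 (upd IM d 0%N) RM) L0 ->
  lb a (State q IM RM) (x * L1 + (1 - x) * L0).
Proof.
move=> ei a0 <- hq h1 h0 [|T] le; first by lia.
rewrite /= ei /= clamp01_id //; case/andP: hq => q0 q1.
apply: lerD; apply: ler_wpM2l => //; first by apply: h1; lia.
  by rewrite subr_ge0.
by apply: h0; lia.
Qed.

(** [succ_prob] recognizes [Halt] before it looks at the fuel, hence the budget 0. *)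
Lemma lb_halt q IM RM : nth Halt plc_prog q = Halt ->
  lb 0 (State q IM RM) (good (RM 0%N))%:R.
Proof. by move=> ei [|T] _ /=; rewrite ei /=; case: good. Qed.

End Machine.


Arguments upd T f a v x /.

Ltac read_registers :=
  repeat match goal with
  | H : ?f ?c = _ |- context [?f ?c] => is_var f; rewrite H
  end.

Ltac step := apply: (lb_step (i := _)); [exact: erefl | exact: erefl | lia | ];
  rewrite /dstep ?upd_high ?upd_low //=; read_registers; rewrite ?subn1 //=.

Ltac frame := rewrite ?upd_high ?upd_low //=; read_registers.

(** * Marking the ranked items and computing [zkp] by dynamic programming *)

Section Loops.
Variables (R : realType) (env : input R) (good : pred R) (n k : nat).
Local Notation lb := (@lb R env good).
Local Notation u := (in_u env).
Local Notation p := (in_p env).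
Local Notation r := (in_r env).

Definition Ibase (IM : nat -> nat) : Prop :=
  [/\ IM 0%N = n, IM 1%N = k, IM 2%N = 1%N, IM 3%N = 16%N & IM 5%N = 0%N].

Definition Rbase (eps delta : R) (RM : nat -> R) : Prop :=
  [/\ RM 0%N = eps, RM 1%N = delta, RM 2%N = 1 & RM 3%N = 2].

(** The marking loop counts down, so the ranks already handled are [t, ..., k-1]. The flag is a
    boolean read as 0 or 1. *)
Definition marked (t : nat) (IM : nat -> nat) : Prop :=
  forall x, IM (16 + x)%N = (x \in map r (iota t (k - t))).

(** Continuation form: a bound [L] valid with budget [b] at the exit is valid at the loop head once
    the cost of the loop is added, here 8 steps per rank and 2 to leave. Most loop lemmas below have
    this form. *)
Lemma mark_loop L a b K0 eps delta t IM RM : (t <= k)%N ->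
  Ibase IM -> IM 4%N = t -> marked t IM ->
  Rbase eps delta RM -> RM 5%N = K0 -> (forall x, RM (16 + x)%N = 0) ->
  (forall IM' RM', Ibase IM' -> marked 0 IM' ->
     Rbase eps delta RM' -> RM' 5%N = K0 * \prod_(s < t) p (r s) ->
     (forall x, RM' (16 + x)%N = 0) ->
     lb b (State 17 IM' RM') L) ->
  (b + 2 + 8 * t <= a)%N -> lb a (State 8 IM RM) L.
Proof.
elim: t a K0 IM RM => [|t IH] a K0 IM RM tk [I0 I1 I2 I3 I5] I4 mk [R0 R1 R2 R3]
  R5 RA Hpost ab.
  do 2 step.
  apply: lb_weaken (Hpost _ _ _ _ _ _ _) _ => //; last by lia.
  by rewrite big_ord0 mulr1.
do 8 step.
apply: (IH _ (K0 * p (r t))); last by lia.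
all: try (by try split; frame); try lia.
- move=> x /=; rewrite eqn_add2l.
  have -> : (k - t)%N = (k - t.+1).+1 by lia.
  by rewrite /= inE; case: eqP => //= _; frame.
move=> IM' RM' HI Hm HR H5; apply: Hpost => //.
by rewrite H5 big_ord_recr /= -mulrA; congr (_ * _); rewrite mulrC.
Qed.

(* [tail_prob i j] is the probability that at least [j] of the items
   [0, ..., i-1] are considered. *)
Fixpoint tail_prob (i j : nat) : R :=
  if i is i'.+1 then p i' * tail_prob i' j.-1 + (1 - p i') * tail_prob i' j
  else (j == 0%N)%:R.

Lemma tail_prob0 i : tail_prob i 0 = 1.
Proof. by elim: i => //= i ->; ring. Qed.

(** The table is updated in place from index [k] down to 1: entries above [j] already belong to
    [i.+1], while entry [j.-1], needed for entry [j], still belongs to [i]. *)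
Lemma dp_inner_loop L a b K eps delta i j IM RM : (j <= k)%N ->
  Ibase IM -> IM 4%N = i -> IM 6%N = j -> marked 0 IM ->
  Rbase eps delta RM -> RM 5%N = K -> RM 6%N = p i -> RM 7%N = 1 - p i ->
  (forall x, (x <= k)%N -> RM (16 + x)%N = tail_prob (if (j < x)%N then i.+1 else i) x) ->
  (forall IM' RM', Ibase IM' -> IM' 4%N = i -> marked 0 IM' ->
     Rbase eps delta RM' -> RM' 5%N = K ->
     (forall x, (x <= k)%N -> RM' (16 + x)%N = tail_prob i.+1 x) ->
     lb b (State 36 IM' RM') L) ->
  (b + 2 + 11 * j <= a)%N -> lb a (State 24 IM RM) L.
Proof.
elim: j a IM RM => [|j IH] a IM RM jk [I0 I1 I2 I3 I5] I4 I6 mk [R0 R1 R2 R3]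
  R5 R6 R7 RA Hpost ab.
  do 2 step.
  apply: lb_weaken (Hpost _ _ _ _ _ _ _ _) _ => //; last by lia.
  (* Entry 0 is never rewritten; it equals 1 for every [i]. *)
  by move=> [|x] xk; rewrite RA // !tail_prob0.
do 3 step. rewrite RA // ltnn.
do 5 step. rewrite (RA j); last by lia.
rewrite (_ : (j.+1 < j)%N = false); last by lia.
do 3 step.
apply: IH; last by lia.
all: try (by try split; frame); try lia.
all: try (by move=> x; frame).
- move=> x xk /=; rewrite eqn_add2l; case: eqP => [->|nx].
    by rewrite ltnSn /= addrC; congr (_ + _); rewrite mulrC.
  frame; rewrite RA //.
  by have -> : (j < x)%N = (j.+1 < x)%N by lia.
Qed.

Lemma dp_outer_loop L a b K eps delta i d IM RM : (i + d)%N = n ->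
  Ibase IM -> IM 4%N = i -> marked 0 IM ->
  Rbase eps delta RM -> RM 5%N = K ->
  (forall x, (x <= k)%N -> RM (16 + x)%N = tail_prob i x) ->
  (forall IM' RM', Ibase IM' -> marked 0 IM' ->
     Rbase eps delta RM' -> RM' 5%N = K ->
     RM' (16 + k)%N = tail_prob n k ->
     lb b (State 38 IM' RM') L) ->
  (b + 2 + (8 + 11 * k) * d <= a)%N -> lb a (State 19 IM RM) L.
Proof.
elim: d a i IM RM => [|d IH] a i IM RM id [I0 I1 I2 I3 I5] I4 mk [R0 R1 R2 R3]
  R5 RA Hpost ab.
  have {}id : i = n by lia.
  rewrite {}id in I4 RA *.
  step. rewrite ltnn. step.
  apply: lb_weaken (Hpost _ _ _ _ _ _ _) _ => //; last by lia.
  exact: (RA _ (leqnn k)).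
step. have -> : (i < n)%N by lia.
do 3 step. rewrite addn0.
apply: (@dp_inner_loop _ _ (b + 4 + (8 + 11 * k) * d) K eps delta i k); last by nia.
all: try (by try split; frame).
all: try (by move=> x; frame).
- by move=> x xk; frame; rewrite ltnNge xk /= RA.
move=> IM' RM' [I0' I1' I2' I3' I5'] I4' mk' [R0' R1' R2' R3'] R5' RA'.
do 2 step. rewrite addn1.
apply: (IH _ i.+1); last by nia.
all: try (by try split; frame); try lia.
all: by move=> x; frame.
Qed.
End Loops.

(** * The sampling loop and its success probability *)

Section Sampling.
Variables (R : realType) (env : input R) (good : pred R) (n k : nat).
Local Notation lb := (@lb R env good).
Local Notation u := (in_u env).
Local Notation p := (in_p env).
Local Notation r := (in_r env).
Local Notation Ibase := (Ibase n k).
Local Notation marked := (marked env k).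
Local Notation tail_prob := (tail_prob env).

(* Ranked items get flip probability [0]: they are forced into the consideration
   set and their weights are added by [pl_value]. *)
Definition flip_prob (i : nat) : R := p i * (1 - (i \in map r (iota 0 k)))%N%:R.

(** Expectation of [G] at the weight accumulated by the flips for items [i-1, ..., 0], starting from
    [S]. *)
Fixpoint flip_expect (G : R -> R) (i : nat) (S : R) : R :=
  if i is i'.+1 then
    flip_prob i' * flip_expect G i' (S + expR (u i')) +
    (1 - flip_prob i') * flip_expect G i' S
  else G S.

(** Ranks are visited from last to first. [S] holds the weight of the sampled unranked items and of
    the ranks visited so far, so [S + w] is the Plackett-Luce denominator at rank [t']; [X]
    accumulates the product. *)
Fixpoint pl_value (t : nat) (S X : R) : R :=
  if t is t'.+1 then
    let w := expR (u (r t')) in pl_value t' (S + w) (X * w / (S + w))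
  else X.

(** Probability that the final average is [good] when [d] of the [m] samples remain and the others
    sum to [s]. *)
Fixpoint sampling_value (m d : nat) (K s : R) : R :=
  if d is d'.+1 then
    flip_expect (fun S => sampling_value m d' K (s + pl_value k S K)) n 0
  else (good (s / m%:R))%:R.

Definition Sbase (delta K acc D s c : R) (RM : nat -> R) : Prop :=
  [/\ RM 1%N = delta, RM 2%N = 1, RM 5%N = K, RM 6%N = acc &
   [/\ RM 7%N = D, RM 8%N = s & RM 9%N = c]].

(** Both outcomes of [Flip] run the same code: the bit multiplies the weight, so only the
    accumulated sum differs. By the bounds on [flip_prob], clamping changes nothing. *)
Lemma flip_loop G a b delta K acc D s c i S IM RM :
  (forall j, (j < i)%N -> 0 <= flip_prob j <= 1) ->
  Ibase IM -> IM 4%N = i -> marked 0 IM ->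
  Sbase delta K acc D s c RM -> RM 10%N = S ->
  (forall IM' RM' S', Ibase IM' -> marked 0 IM' ->
     Sbase delta K acc D s c RM' -> RM' 10%N = S' ->
     lb b (State 72 IM' RM') (G S')) ->
  (b + 2 + 15 * i <= a)%N -> lb a (State 56 IM RM) (flip_expect G i S).
Proof.
elim: i a S IM RM => [|i IH] a S IM RM q01 [I0 I1 I2 I3 I5] I4 mk
  [R1 R2 R5 R6 [R7 R8 R9]] R10 Hpost ab.
  do 2 step.
  by apply: lb_weaken (Hpost _ _ _ _ _ _ _) _ => //; lia.
have mki := mk i; rewrite subn0 in mki.
do 8 step.
apply: (lb_flip (d := 6) (j := 11)); [exact: erefl | lia | by frame | exact: q01 | |].
- do 6 step.
  apply: IH; last by lia.
  all: try (by try split; frame); try lia.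
  + by move=> j ji; apply: q01; lia.
  + by frame; rewrite mulr1.
- do 6 step.
  apply: IH; last by lia.
  all: try (by try split; frame); try lia.
  + by move=> j ji; apply: q01; lia.
  + by frame; rewrite mulr0 addr0.
Qed.

Lemma pl_loop L a b delta K acc D s c t S X IM RM :
  Ibase IM -> IM 4%N = t -> marked 0 IM ->
  Sbase delta K acc D s c RM -> RM 10%N = S -> RM 11%N = X ->
  (forall IM' RM', Ibase IM' -> marked 0 IM' ->
     Sbase delta K acc D s c RM' -> RM' 11%N = pl_value t S X ->
     lb b (State 84 IM' RM') L) ->
  (b + 2 + 9 * t <= a)%N -> lb a (State 74 IM RM) L.
Proof.
elim: t a S X IM RM => [|t IH] a S X IM RM [I0 I1 I2 I3 I5] I4 mk
  [R1 R2 R5 R6 [R7 R8 R9]] R10 R11 Hpost ab.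
  do 2 step.
  by apply: lb_weaken (Hpost _ _ _ _ _ _) _ => //; lia.
do 9 step.
pose w := expR (u (r t)).
apply: (IH _ (S + w) (X * w / (S + w))); last by lia.
all: try (by try split; frame); try lia.
all: try (by move=> x; frame).
Qed.

(** The loop test compares [delta] with [2 * D ^+ i]; the two hypotheses on [D] make it succeed for
    [i < m] and fail at [m], so exactly [m] samples are drawn. *)
Lemma sampling_loop m a delta K D i d s IM RM :
  (forall j, (j < n)%N -> 0 <= flip_prob j <= 1) ->
  (forall j, (j < m)%N -> delta < 2 * D ^+ j) -> 2 * D ^+ m <= delta ->
  (i + d)%N = m -> Ibase IM -> marked 0 IM ->
  Sbase delta K (2 * D ^+ i) D s i%:R RM ->
  (3 + (13 + 15 * n + 9 * k) * d <= a)%N ->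
  lb a (State 50 IM RM) (sampling_value m d K s).
Proof.
move=> q01 Dlt Dle.
elim: d a i s IM RM => [|d IH] a i s IM RM id [I0 I1 I2 I3 I5] mk
  [R1 R2 R5 R6 [R7 R8 R9]] ab.
  rewrite addn0 in id; rewrite id in R6 R9.
  step. rewrite ltNge Dle /=. do 2 step.
  apply: (@lb_weaken _ _ _ 0) => //; apply: lb_le (lb_halt _ _ _ _ _) _ => //=.
step. rewrite Dlt; last by lia.
do 4 step. rewrite addn0.
set b := (6 + 9 * k + (3 + (13 + 15 * n + 9 * k) * d))%N.
have bE : b = (6 + 9 * k + (3 + (13 + 15 * n + 9 * k) * d))%N by [].
apply: (@flip_loop _ _ b delta K (2 * D ^+ i.+1) D s i.+1%:R) => //; last by nia.
all: try (by move=> x; frame).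
- by split => //; frame => //; [rewrite exprSr mulrA | split => //; frame; rewrite natr1].
move=> {}IM {}RM S {I0 I1 I2 I3 I5 R1 R2 R5 R6 R7 R8 R9} [I0 I1 I2 I3 I5] {}mk
  [R1 R2 R5 R6 [R7 R8 R9]] R10.
do 2 step. rewrite addn0.
apply: (@pl_loop _ _ (2 + (3 + (13 + 15 * n + 9 * k) * d)) delta K (2 * D ^+ i.+1) D s
  i.+1%:R k S K) => //; try lia.
all: try (by move=> x; frame).
- by frame; rewrite mulr1.
move=> {}IM {}RM {I0 I1 I2 I3 I5 R1 R2 R5 R6 R7 R8 R9 R10} [I0 I1 I2 I3 I5] {}mk
  [R1 R2 R5 R6 [R7 R8 R9]] R11.
do 2 step.
by apply: (IH _ i.+1); try lia.
Qed.

Lemma run_sampling m a eps delta :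
  (forall j, (j < n)%N -> 0 <= flip_prob j <= 1) ->
  let D := expR (- (eps ^+ 2 / 4)) in
  (forall j, (j < m)%N -> delta < 2 * D ^+ j) -> 2 * D ^+ m <= delta ->
  eps <= 1 / 2 ->
  (31 + 8 * k + (8 + 11 * k) * n + (13 + 15 * n + 9 * k) * m <= a)%N ->
  lb a (init_state n k eps delta)
    (sampling_value m m ((\prod_(s < k) p (r s)) / tail_prob n k) 0).
Proof.
move=> q01 D Dlt Dle epsle ab; rewrite /init_state.
set b3 := (3 + (13 + 15 * n + 9 * k) * m)%N in ab *.
have b3E : b3 = (3 + (13 + 15 * n + 9 * k) * m)%N by [].
have two : 1 + 1 = 2 :> R by [].
do 6 step. rewrite two ltNge epsle /=.
do 2 step. rewrite addn0.
apply: (@mark_loop _ env good n k _ _ (2 + (2 + (8 + 11 * k) * n + (12 + b3))) 1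
  eps delta k) => //; last by lia.
- by move=> x; rewrite subnn; frame.
all: try (by move=> x; frame).
move=> IM RM [I0 I1 I2 I3 I5] mk [R0 R1 R2 R3] R5 RA.
do 2 step.
apply: (@dp_outer_loop _ env good n k _ _ (12 + b3) (1 * \prod_(s < k) p (r s))
  eps delta 0 n) => //; try lia.
all: try (by move=> x; frame).
- by move=> x xk /=; case: eqP => e; rewrite ?RA /=; case: x xk e => [|x] xk e //; lia.
move=> {}IM {}RM {I0 I1 I2 I3 I5 R0 R1 R2 R3 R5 RA} [I0 I1 I2 I3 I5] {}mk
  [R0 R1 R2 R3] R5 RA.
do 12 step.
apply: (@sampling_loop m _ delta _ D 0 m) => //; try lia.
all: try (by move=> x; frame).
split => //; frame; rewrite ?expr0 ?mulr1 ?mul1r //.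
split => //; frame; rewrite /D sub0r expr2; congr (expR (- (_ / _))).
by rewrite -natrD.
Qed.

Lemma run_half a eps delta : 1 / 2 < eps -> (8 <= a)%N ->
  lb a (init_state n k eps delta) (good (1 / 2))%:R.
Proof.
move=> epsgt ab; rewrite /init_state.
do 6 step. rewrite (_ : 1 + 1 = 2 :> R) // epsgt /=.
step.
apply: (@lb_weaken _ _ _ 0) => //; apply: lb_le (lb_halt _ _ _ _ _) _ => //=.
by rewrite mulr1.
Qed.
End Sampling.

(** * Expectations over random subsets *)

Section SubsetSums.
Variables (R : realType) (I : finType) (q : I -> R).

(** Expectation of [F] at a random subset of [A] that contains each [h] independently with
    probability [q h]. Keeping [A] arbitrary allows elements to be removed one at a time, as the
    recursions above do. *)
Definition subset_expect (A : {set I}) (F : {set I} -> R) : R :=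
  \sum_(C : {set I} | C \subset A)
    (\prod_(h in C) q h) * (\prod_(h in A :\: C) (1 - q h)) * F C.

Lemma subset_expect0 F : subset_expect set0 F = F set0.
Proof.
rewrite /subset_expect (big_pred1 set0) => [|C]; last by rewrite subset0.
by rewrite set0D !big_set0 !mul1r.
Qed.

(** Conditioning on whether [x] is chosen; the sets containing [x] are reindexed by
    [C |-> x |: C]. *)
Lemma subset_expectU1 x (A : {set I}) F : x \notin A ->
  subset_expect (x |: A) F =
  q x * subset_expect A (fun C => F (x |: C)) + (1 - q x) * subset_expect A F.
Proof.
move=> xA; rewrite /subset_expect (bigID (fun C : {set I} => x \in C)) /=.
congr (_ + _); rewrite mulr_sumr.
  rewrite (reindex_onto (fun C => x |: C) (fun C => C :\ x)) /=; last first.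
    by move=> C /andP[_ xC]; rewrite setD1K.
  apply: eq_big => [C|C /andP[_ /eqP CE]].
    rewrite setU11 andbT; apply/andP/idP => [[sub /eqP CE]|sub].
      have xC : x \notin C by rewrite -CE !inE eqxx.
      apply/fintype.subsetP => y yC; have := fintype.subsetP sub y.
      rewrite !inE yC orbT => /(_ isT) /orP[/eqP yx|//].
      by rewrite -yx yC in xC.
    split; first exact: setUS.
    by rewrite setU1K //; apply: contra xA; apply: (fintype.subsetP sub).
  have xC : x \notin C by rewrite -CE !inE eqxx.
  rewrite big_setU1 //= !mulrA; congr (_ * _ * _).
  apply: eq_bigl => y; rewrite !inE negb_or.
  by case: eqVneq => //= ->; rewrite (negbTE xA) andbF.
apply: eq_big => [C|C /andP[sub xC]].
  apply/andP/idP => [[sub xC]|sub].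
    apply/fintype.subsetP => y yC; have := fintype.subsetP sub y yC; rewrite !inE.
    by case/orP => // /eqP yx; rewrite -yx yC in xC.
  split; first exact: fintype.subset_trans sub (subsetUr _ _).
  by apply: contra xA; apply: (fintype.subsetP sub).
rewrite [X in _ * X * _](bigD1 x) /=; last by rewrite !inE xC eqxx.
rewrite [RHS]mulrA; congr (_ * _); rewrite mulrCA; congr (_ * (_ * _)).
apply: eq_bigl => y; rewrite !inE.
by case: eqVneq => [->|] /=; rewrite ?(negbTE xA) ?andbF ?andbT.
Qed.

Lemma subset_expectT F : subset_expect [set: I] F =
  \sum_(C : {set I}) (\prod_(h in C) q h) * (\prod_(h in ~: C) (1 - q h)) * F C.
Proof. by apply: eq_big => C; rewrite ?subsetT // setTD. Qed.

End SubsetSums.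

(** * Each sample is an unbiased estimate with values in [0, 1] *)

Section Model.
Variables (R : realType) (n k : nat).

(** The items over which [flip_expect] and [tail_prob] range at counter [i]. *)
Definition below (i : nat) : {set 'I_n} := [set h : 'I_n | (h < i)%N].

Lemma below0 : below 0 = set0.
Proof. by apply/setP => h; rewrite !inE. Qed.

Lemma belowS i (lt_i : (i < n)%N) : below i.+1 = Ordinal lt_i |: below i.
Proof. by apply/setP => h; rewrite !inE -val_eqE /= ltnS leq_eqVlt. Qed.

Lemma below_notin i (lt_i : (i < n)%N) : Ordinal lt_i \notin below i.
Proof. by rewrite inE ltnn. Qed.

Lemma belowT : below n = [set: 'I_n].
Proof. by apply/setP => h; rewrite !inE ltn_ord. Qed.

Lemma fun_of_ordE (f : 'I_n -> R) (h : 'I_n) : fun_of_ord f h = f h.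
Proof. by rewrite /fun_of_ord valK. Qed.

Lemma sum_cweight (q : 'I_n -> R) : \sum_C cweight q C = 1.
Proof.
have e i : (i <= n)%N -> subset_expect q (below i) (fun=> 1) = 1.
  elim: i => [|i IH] lt_i; first by rewrite below0 subset_expect0.
  rewrite (belowS lt_i) subset_expectU1 ?below_notin // IH 1?ltnW //; ring.
rewrite -(e n) // belowT subset_expectT.
by apply: eq_bigr => C _; rewrite mulr1.
Qed.

Lemma cweight_ge0 (q : 'I_n -> R) C : (forall i, 0 <= q i <= 1) -> 0 <= cweight q C.
Proof.
move=> q01; rewrite mulr_ge0 // prodr_ge0 // => h _; first by case/andP: (q01 h).
by rewrite subr_ge0; case/andP: (q01 h).
Qed.

Variables (u p : 'I_n -> R) (r : k.-tuple 'I_n).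
Hypothesis r_uniq : uniq r.
Hypothesis p01 : forall i, 0 < p i <= 1.

Let env := encode u p r.
Let rs : {set 'I_n} := [set x in r].
Let q (h : 'I_n) : R := p h * (h \notin rs)%:R.

Lemma q01 h : 0 <= q h <= 1.
Proof.
rewrite /q; have /andP[p0 p1] := p01 h.
by case: (h \notin rs); rewrite ?mulr1 ?mulr0 ?lexx ?ler01 ?p1 ?ltW.
Qed.

Lemma mem_ranked (i : 'I_n) : (val i \in map (in_r env) (iota 0 k)) = (i \in rs).
Proof.
have -> : map (in_r env) (iota 0 k) = map val r.
  by rewrite -[RHS](mkseq_nth 0%N) size_map size_tuple.
by rewrite (mem_map val_inj) inE.
Qed.

Lemma flip_probE (h : 'I_n) : flip_prob env k h = q h.
Proof.
rewrite /flip_prob mem_ranked /= fun_of_ordE /q.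
by case: (h \in rs).
Qed.

Lemma flip_expectE G i S : (i <= n)%N -> flip_expect env k G i S =
  subset_expect q (below i) (fun C => G (S + \sum_(h in C) expR (u h))).
Proof.
elim: i S => [|i IH] S lt_i.
  by rewrite below0 subset_expect0 big_set0 addr0.
rewrite (belowS lt_i) subset_expectU1 ?below_notin //= !IH 1?ltnW //.
rewrite -[X in flip_prob _ _ X]/(val (Ordinal lt_i)) flip_probE.
rewrite -[X in fun_of_ord _ X]/(val (Ordinal lt_i)) fun_of_ordE.
congr (_ * _ + _); apply: eq_bigr => C sub; congr (_ * G _).
rewrite big_setU1 ?addrA //=.
by apply: contra (below_notin lt_i); apply: (fintype.subsetP sub).
Qed.

Lemma flip_expectT G : flip_expect env k G n 0 =
  \sum_C cweight q C * G (\sum_(h in C) expR (u h)).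
Proof.
rewrite flip_expectE // belowT subset_expectT.
by apply: eq_bigr => C _; rewrite add0r.
Qed.

Lemma tail_probE i j : (i <= n)%N -> tail_prob env i j =
  subset_expect p (below i) (fun C => (j <= #|C|)%N%:R).
Proof.
elim: i j => [|i IH] j lt_i.
  by rewrite below0 subset_expect0 cards0 leqn0.
rewrite (belowS lt_i) subset_expectU1 ?below_notin //= !IH 1?ltnW //.
rewrite -[X in fun_of_ord _ X]/(val (Ordinal lt_i)) fun_of_ordE.
congr (_ * _ + _); apply: eq_bigr => C sub; congr (_ * _%:R).
rewrite cardsU1 (_ : Ordinal lt_i \notin C) ?add1n; first by case: j.
by apply: contra (below_notin lt_i); apply: (fintype.subsetP sub).
Qed.

Lemma tail_prob_zkp : tail_prob env n k = zkp k p.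
Proof.
rewrite tail_probE // belowT subset_expectT /zkp [RHS]big_mkcond /=.
by apply: eq_bigr => C _; rewrite /cweight; case: ifP => _; rewrite ?mulr1 ?mulr0.
Qed.

(* Conditioned on containing all ranked items, the consideration set is [rs] plus
   independent choices among the other items. *)
Lemma sum_superset F : \sum_(C : {set 'I_n} | rs \subset C) cweight p C * F C =
  (\prod_(h in rs) p h) * \sum_C cweight q C * F (C :|: rs).
Proof.
rewrite [X in _ * X](bigID (fun C : {set 'I_n} => [disjoint C & rs])) /=.
(* [q] vanishes on [rs], so sets meeting [rs] have weight 0; the remaining sets correspond to the
   supersets of [rs] through [C :|: rs]. *)
rewrite [X in _ * (_ + X)]big1 ?addr0 => [|C]; last first.
  move=> /pred0Pn [h /= /andP[hC hr]].
  by rewrite /cweight (bigD1 h) //= /q hr mulr0 !mul0r.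
rewrite mulr_sumr (reindex_onto (fun C => C :|: rs) (fun C => C :\: rs)) /=; last first.
  move=> C sub; apply/setP => h; have := fintype.subsetP sub h; rewrite !inE.
  by case: (h \in r) => //= [->|_]; rewrite ?orbF.
apply: eq_big => [C|C /andP[_ /eqP CE]].
  rewrite subsetUr /=; apply/eqP/idP => [<-|dis].
    by rewrite disjoint_sym -setI_eq0; apply/eqP/setP => h; rewrite !inE; case: (h \in r).
  apply/setP => h; rewrite !inE; case hr: (h \in r); rewrite ?orbF //=.
  apply/esym/negbTE; apply/negP => hC; move/pred0P: dis => /(_ h) /=.
  by rewrite hC inE hr.
have dis h : h \in C -> h \notin rs by rewrite -CE !inE => /andP[].
rewrite mulrA; congr (_ * _); rewrite /cweight mulrA; congr (_ * _).
  rewrite mulrC (big_setID C) /= setUK; congr (_ * _).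
    by apply: eq_bigr => h /dis hr; rewrite /q hr mulr1.
  apply: eq_bigl => h; rewrite !inE; case hC: (h \in C) => //=.
  by apply/esym/negbTE; have := dis h hC; rewrite inE.
rewrite [RHS](big_setID rs) /= [X in X * _]big1 ?mul1r => [|h].
  rewrite (_ : ~: C :\: rs = ~: (C :|: rs)); last by rewrite setCU setDE.
  by apply: eq_bigr => h; rewrite !inE negb_or => /andP[_ hr]; rewrite /q inE hr mulr1.
by rewrite inE => /andP[_ hr]; rewrite /q hr mulr0 subr0.
Qed.

Lemma card_rs : #|rs| = k.
Proof. by rewrite cardsE (card_uniqP r_uniq) size_tuple. Qed.

Lemma prod_rs (F : 'I_n -> R) : \prod_(h in rs) F h = \prod_(t < k) F (tnth r t).
Proof.
rewrite (eq_bigl (fun h => h \in tval r)) => [|h]; last by rewrite inE.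
by rewrite -big_uniq //= big_tuple.
Qed.

(** The left side is the probability that the unconditioned random set contains [rs]. Since the [k]
    ranked items are distinct, this event forces size at least [k]. *)
Lemma prod_ranked_le_zkp : \prod_(h in rs) p h <= zkp k p.
Proof.
have -> : \prod_(h in rs) p h = \sum_(C : {set 'I_n} | rs \subset C) cweight p C.
  have /= := sum_superset (fun=> 1); under eq_bigr do rewrite mulr1; move->.
  rewrite [X in _ * X](eq_bigr (cweight q)) => [|C _]; last by rewrite mulr1.
  by rewrite sum_cweight mulr1.
rewrite /zkp big_mkcond [leRHS]big_mkcond; apply: ler_sum => C _.
have w0 : 0 <= cweight p C.
  by apply: cweight_ge0 => i; have /andP[/ltW -> ->] := p01 i.
by case: ifP => [/subset_leq_card|_]; [rewrite card_rs => -> | case: ifP].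
Qed.

Lemma prod_ranked_gt0 : 0 < \prod_(h in rs) p h.
Proof. by apply: prodr_gt0 => h _; case/andP: (p01 h). Qed.

Lemma zkp_gt0 : 0 < zkp k p.
Proof. exact: lt_le_trans prod_ranked_gt0 prod_ranked_le_zkp. Qed.

Lemma zkp_le1 : zkp k p <= 1.
Proof.
rewrite -(sum_cweight p) /zkp big_mkcond; apply: ler_sum => C _.
by case: ifP => // _; apply: cweight_ge0 => i; have /andP[/ltW -> ->] := p01 i.
Qed.

Lemma in_rE (t : 'I_k) : in_r env t = tnth r t.
Proof. by rewrite /= (nth_map (tnth r t)) ?size_tuple // -tnth_nth. Qed.

Lemma prod_rankedE : \prod_(s < k) in_p env (in_r env s) = \prod_(h in rs) p h.
Proof. by rewrite prod_rs; apply: eq_bigr => t _; rewrite in_rE /= fun_of_ordE. Qed.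

(** Unrolling the recursion shows the denominator at rank [j] as [S] plus the weights of the ranks
    [j, ..., t-1]. *)
Lemma pl_valueE t S X : pl_value env t S X = X * \prod_(j < t)
  (expR (in_u env (in_r env j)) /
    (S + \sum_(j <= s < t) expR (in_u env (in_r env s)))).
Proof.
elim: t S X => [|t IH] S X; first by rewrite big_ord0 mulr1.
rewrite [LHS]IH big_ord_recr /= big_nat1 -!mulrA; congr (_ * _).
rewrite mulrA mulrC; congr (_ * _); apply: eq_bigr => j _.
by rewrite big_nat_recr 1?ltnW //= -addrA [expR _ + _]addrC.
Qed.

(** As the ranking has no repetition, removing the ranks before [t] from [C :|: rs] leaves [C] and
    the ranks from [t] on, which is the denominator in [pl_valueE]. *)
Lemma PrPL_superset (C : {set 'I_n}) : [disjoint C & rs] ->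
  PrPL u r (C :|: rs) = pl_value env k (\sum_(h in C) expR (u h)) 1.
Proof.
move=> dis; rewrite /PrPL ifT; last first.
  by apply/forallP => t; rewrite !inE mem_tnth orbT.
rewrite pl_valueE mul1r; apply: eq_bigr => t _.
have wE (s : 'I_k) : expR (in_u env (in_r env s)) = expR (u (tnth r s)).
  by rewrite in_rE [in_u _ _]fun_of_ordE.
rewrite wE; congr (_ / _).
have r_inj : injective (tnth r) by apply/tuple_uniqP.
rewrite (big_setID rs) /= addrC; congr (_ + _).
  apply: eq_bigl => h; rewrite !inE; case hr: (h \in r) => /=.
    by apply/esym/negbTE/negP => hC; move/pred0P: dis => /(_ h) /=; rewrite hC inE hr.
  rewrite orbF; case hC: (h \in C); rewrite ?andbF // andbT.
  by apply/imsetP => -[s _ hs]; rewrite hs mem_tnth in hr.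
rewrite big_geq_mkord.
rewrite (_ : _ :&: rs = [set tnth r s | s : 'I_k & (t <= s)%N]).
  rewrite big_imset /=; last by move=> ? ? _ _; apply: r_inj.
  by apply: eq_big => [s|s _]; [rewrite inE | exact/esym/wE].
apply/setP => h; rewrite !inE.
apply/andP/imsetP => [[/andP[ns _] /tnthP [s hs]]|[s]].
  exists s => //; rewrite inE leqNgt; apply: contra ns => lt_s.
  by apply/imsetP; exists s; rewrite ?inE.
rewrite inE => le_s ->; rewrite mem_tnth orbT; split => //; rewrite andbT.
by apply/imsetP => -[s']; rewrite inE => lt_s /r_inj e; rewrite -e ltnNge le_s in lt_s.
Qed.

Lemma pl_valueZ t S X : pl_value env t S X = X * pl_value env t S 1.
Proof. by rewrite !pl_valueE mul1r. Qed.

(** [PrPL] vanishes unless [C] contains [rs], and then the size condition of [PrC] holds, so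
    [sum_superset] turns the sum into an expectation over the independent flips. *)
Lemma mean_pl_value :
  \sum_C cweight q C * pl_value env k (\sum_(h in C) expR (u h))
    ((\prod_(s < k) in_p env (in_r env s)) / tail_prob env n k) = PrPLC u p r.
Proof.
rewrite prod_rankedE tail_prob_zkp /PrPLC.
rewrite [RHS](bigID (fun C : {set 'I_n} => rs \subset C)) /=.
rewrite [X in _ = _ + X]big1 ?addr0 => [|C nsub]; last first.
  rewrite /PrPL ifF ?mulr0 //; apply: contraNF nsub => /forallP rC.
  by apply/fintype.subsetP => h; rewrite inE => /tnthP [t ->].
transitivity (\sum_(C : {set 'I_n} | rs \subset C) cweight p C * (PrPL u r C / zkp k p)).
  rewrite sum_superset mulr_sumr; apply: eq_bigr => C _.
  have [dis|/pred0Pn [h /= /andP[hC hr]]] := boolP [disjoint C & rs].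
    by rewrite PrPL_superset // pl_valueZ; ring.
  by rewrite /cweight (bigD1 h) //= /q hr mulr0 !mul0r mulr0.
apply: eq_bigr => C sub; rewrite /PrC ifT; first by ring.
by rewrite -card_rs subset_leq_card.
Qed.

(** Every factor [w / (S + w)] is at most 1, so [X] stays in [0, 1]. *)
Lemma pl_value_01 t S X : 0 <= S -> 0 <= X <= 1 -> 0 <= pl_value env t S X <= 1.
Proof.
elim: t S X => [//|t IH] S X S0 /andP[X0 X1] /=.
set w := expR _; have w0 : 0 < w by apply: expR_gt0.
have Sw : 0 < S + w by apply: ltr_wpDl.
apply: IH; first exact: ltW.
apply/andP; split; first by rewrite divr_ge0 ?mulr_ge0 // ltW.
rewrite ler_pdivrMr // mul1r.
by apply: le_trans (ler_wpM2r (ltW w0) X1) _; rewrite mul1r lerDr.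
Qed.

Lemma sample_01 (C : {set 'I_n}) :
  0 <= pl_value env k (\sum_(h in C) expR (u h))
    ((\prod_(s < k) in_p env (in_r env s)) / tail_prob env n k) <= 1.
Proof.
apply: pl_value_01; first by apply: sumr_ge0 => h _; apply: expR_ge0.
have P0 := prod_ranked_gt0; have z0 := zkp_gt0.
rewrite prod_rankedE tail_prob_zkp; apply/andP; split; first by rewrite divr_ge0 // ltW.
by rewrite ler_pdivrMr ?zkp_gt0 // mul1r prod_ranked_le_zkp.
Qed.

End Model.

(** * Chernoff bound for the average of the samples *)

Section Concentration.
Variable R : realType.

(** From [expR (- y) >= 1 - y] and [(1 + y + 2 y^2) (1 - y) = 1 + y^2 (1 - 2 y) >= 1]. *)
Lemma expR_le_quadratic (y : R) : y <= 1 / 2 -> expR y <= 1 + y + 2 * y ^+ 2.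
Proof.
move=> y2; have e0 := expR_gt0 (- y).
have := expR_ge1Dx (- y) => e1.
rewrite -[y in expR y]opprK expRN -div1r ler_pdivrMr //.
apply: le_trans (ler_wpM2l _ e1); first by nra.
by nra.
Qed.

(** Bounding the exponential by the quadratic and [X^2] by [X] gives a majorant linear in [X]. Its
    mean is [1 + 2 l^2 mu (1 - mu) <= 1 + l^2 <= expR (l^2)]. *)
Lemma mgf_le (I : finType) (w X : I -> R) (mu l : R) :
  (forall i, 0 <= w i) -> \sum_i w i = 1 -> (forall i, 0 <= X i <= 1) ->
  \sum_i w i * X i = mu -> - (1 / 2) <= l <= 1 / 2 ->
  \sum_i w i * expR (l * (X i - mu)) <= expR (l ^+ 2).
Proof.
move=> w0 w1 X01 wX /andP[l1 l2].
have mu0 : 0 <= mu.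
  by rewrite -wX sumr_ge0 // => i _; rewrite mulr_ge0 //; case/andP: (X01 i).
have mu1 : mu <= 1.
  rewrite -wX -w1; apply: ler_sum => i _; rewrite ler_piMr //; by case/andP: (X01 i).
apply: (@le_trans _ _ (\sum_i (w i * X i * (l + 2 * l ^+ 2 * (1 - 2 * mu)) +
   w i * (1 - l * mu + 2 * l ^+ 2 * mu ^+ 2)))).
  apply: ler_sum => i _; have /andP[x0 x1] := X01 i.
  rewrite -mulrA -mulrDr; apply: ler_wpM2l => //.
  apply: le_trans (expR_le_quadratic _) _; first by nra.
  have : 0 <= l ^+ 2 * (X i * (1 - X i)).
    by rewrite mulr_ge0 ?sqr_ge0 // mulr_ge0 // subr_ge0.
  move=> h; rewrite -subr_ge0.
  rewrite (_ : _ - _ = 2 * (l ^+ 2 * (X i * (1 - X i)))); last by ring.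
  exact: mulr_ge0.
rewrite big_split /= -!mulr_suml wX w1.
apply: le_trans (expR_ge1Dx _).
have := sqr_ge0 (1 - 2 * mu); have := sqr_ge0 l; nra.
Qed.

End Concentration.

(** With [d] samples left and [i] drawn, the failure probability is at most the sum of the
    exponential potentials [phi d] at [l (s - i mu)] and at its negative, one for each tail. By
    [mgf_le], one more sample moves the mean of [phi d] to at most [phi d.+1]. *)
Lemma sampling_value_ge (R : realType) (env : input R) (n k m : nat) (K mu eps : R)
    (I : finType) (w S : I -> R) :
  (forall G, flip_expect env k G n 0 = \sum_i w i * G (S i)) ->
  (forall i, 0 <= w i) -> \sum_i w i = 1 ->
  (forall i, 0 <= pl_value env k (S i) K <= 1) ->
  \sum_i w i * pl_value env k (S i) K = mu ->
  0 < eps <= 1 / 2 -> (0 < m)%N ->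
  1 - 2 * expR (- (eps ^+ 2 / 4)) ^+ m <=
    sampling_value env (fun x => `|x - mu| < eps) n k m m K 0.
Proof.
move=> flipE w0 w1 X01 wX /andP[eps0 eps2] m0.
(* This minimizes [l^2 - l * eps], with value [- eps^2 / 4]; it also lies in the range allowed by
   [mgf_le]. *)
pose l := eps / 2.
pose sv d s := sampling_value env (fun x => `|x - mu| < eps) n k m d K s.
pose phi d y := expR (y + d%:R * l ^+ 2 - l * (m%:R * eps)).
have phi0 d y : 0 <= phi d y by apply: expR_ge0.
have phi_ge1 y : l * (m%:R * eps) <= y -> 1 <= phi 0%N y.
  move=> le_y; apply: le_trans (expR_ge1Dx _); rewrite mul0r; lra.
have phiS d (l' s i : R) : l' ^+ 2 = l ^+ 2 -> - (1 / 2) <= l' <= 1 / 2 ->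
    \sum_j w j * phi d (l' * (s + pl_value env k (S j) K - (i + 1) * mu)) <=
    phi d.+1 (l' * (s - i * mu)).
  move=> l2 lb; pose y := l' * (s - i * mu) + d%:R * l ^+ 2 - l * (m%:R * eps).
  have -> : phi d.+1 (l' * (s - i * mu)) = expR y * expR (l' ^+ 2).
    rewrite -expRD /phi /y l2; congr expR; rewrite -natr1; ring.
  apply: le_trans (ler_wpM2l (expR_ge0 _) (mgf_le w0 w1 X01 wX lb)).
  rewrite mulr_sumr; apply: ler_sum => j _; rewrite mulrCA; apply: ler_wpM2l => //.
  rewrite -expRD; rewrite le_eqVlt; apply/orP; left; apply/eqP.
  by rewrite /phi /y; congr expR; ring.
have main d i s : (i + d)%N = m ->
    1 - (phi d (l * (s - i%:R * mu)) + phi d (- l * (s - i%:R * mu))) <= sv d s.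
  elim: d i s => [|d IH] i s id.
    rewrite addn0 in id; subst i.
    have mR0 : 0 < m%:R :> R by rewrite ltr0n.
    rewrite /sv /=; case: ltP => bad /=.
      by rewrite gerBl addr_ge0.
    rewrite subr_le0.
    have : m%:R * eps <= `|s - m%:R * mu|.
      have -> : s - m%:R * mu = m%:R * (s / m%:R - mu).
        by field; rewrite lt0r_neq0.
      by rewrite normrM gtr0_norm // ler_wpM2l // ltW.
    have l0 : 0 <= l by rewrite /l; lra.
    (* A final error of at least [eps] makes the potential of the matching tail at least 1, so the
       claimed lower bound is at most 0. *)
    rewrite ler_normr => /orP[] h.
      apply: le_trans (phi_ge1 _ (ler_wpM2l l0 h)) _; by rewrite lerDl.
    rewrite mulNr -mulrN; apply: le_trans (phi_ge1 _ (ler_wpM2l l0 h)) _.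
    by rewrite lerDr.
  rewrite /sv /= flipE.
  apply: (@le_trans _ _ (\sum_j w j * (1 -
    (phi d (l * (s + pl_value env k (S j) K - (i%:R + 1) * mu)) +
     phi d (- l * (s + pl_value env k (S j) K - (i%:R + 1) * mu)))))); last first.
    apply: ler_sum => j _; apply: ler_wpM2l => //.
    by rewrite natr1; apply: IH; lia.
  rewrite (eq_bigr (fun j => w j -
    (w j * phi d (l * (s + pl_value env k (S j) K - (i%:R + 1) * mu)) +
     w j * phi d (- l * (s + pl_value env k (S j) K - (i%:R + 1) * mu))))); last first.
    by move=> j _; rewrite mulrBr mulr1 mulrDr.
  rewrite sumrB w1 lerD2l lerN2 big_split /=.
  by apply: lerD; apply: phiS; rewrite ?sqrrN //; rewrite /l; apply/andP; split; lra.
apply: le_trans (main m 0%N 0 _) => //.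
rewrite mul0r subr0 !mulr0 lerD2l lerN2 -mulr2n -[_ *+ 2]mulr_natl ler_pM2l //.
rewrite /phi -expRM_natl; rewrite le_eqVlt; apply/orP; left; apply/eqP.
by congr expR; rewrite /l -mulr_natl; field.
Qed.

(** * Number of samples, running time and the final bound *)

(** For the least admissible [m > 0], the value [m - 1] fails, which reads
    [(m - 1) eps^2 / 4 < ln (2 / delta)]; then [ln 2 <= 1] gives the bound. *)
Lemma sample_count (R : realType) (eps delta : R) : 0 < eps -> 0 < delta < 1 ->
  let D := expR (- (eps ^+ 2 / 4)) in
  exists m : nat, [/\ forall j, (j < m)%N -> delta < 2 * D ^+ j,
    2 * D ^+ m <= delta & m%:R <= 1 + 4 * (1 + ln delta^-1) / eps ^+ 2].
Proof.
move=> eps0 /andP[d0 d1] D.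
pose b := eps ^+ 2 / 4.
have b0 : 0 < b by rewrite divr_gt0 // exprn_gt0.
have DE j : D ^+ j = expR (- (j%:R * b)) by rewrite /D -expRM_natl -/b mulrN.
have dE (j : nat) : (2 * D ^+ j <= delta) = (ln (2 / delta) <= j%:R * b).
  rewrite DE expRN ler_pdivrMr ?expR_gt0 // -ler_pdivrMl //.
  rewrite mulrC -[X in _ = (_ <= X)](expRK (j%:R * b)) ler_ln // posrE ?expR_gt0 //.
  by rewrite divr_gt0.
have ex : exists j : nat, 2 * D ^+ j <= delta.
  exists (Num.bound `|ln (2 / delta) / b|); rewrite dE -ler_pdivrMr //.
  apply: ltW; apply: le_lt_trans (ler_norm _) _; exact: archi_boundP (normr_ge0 _).
case: (ex_minnP ex) => m Pm mmin; exists m; split => //.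
  by move=> j jm; rewrite ltNge; apply/negP => /mmin; rewrite leqNgt jm.
case: m Pm mmin => [|m] _ mmin.
  rewrite addr_ge0 // divr_ge0 ?sqr_ge0 // mulr_ge0 // addr_ge0 // ln_ge0 //.
  by rewrite invf_ge1 // ltW.
rewrite -natr1 addrC lerD2l.
have : ~~ (2 * D ^+ m <= delta) by apply/negP => /mmin; rewrite ltnn.
rewrite dE -ltNge => lt_m.
have ln2 : ln 2 <= 1 :> R.
  by apply: le_ln1Dx; apply: lt_trans ltr01; rewrite oppr_lt0 ltr01.
have : m%:R * b <= 1 + ln delta^-1.
  rewrite lnM ?posrE ?invr_gt0 // in lt_m; lra.
rewrite -ler_pdivlMr // /b => h; apply: le_trans h _.
rewrite le_eqVlt; apply/orP; left; apply/eqP; field.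
by rewrite lt0r_neq0.
Qed.

(** Each of 1, [k] and [n] is at most [k * n]; 58 = 31 + 8 + 8 + 11 and 37 = 13 + 15 + 9 collect the
    coefficients. *)
Lemma running_time_le (k n m : nat) : (0 < k)%N -> (0 < n)%N ->
  (31 + 8 * k + (8 + 11 * k) * n + (13 + 15 * n + 9 * k) * m <=
   (k * n) * (58 + 37 * m))%N.
Proof.
move=> k0 n0; have kN : (k <= k * n)%N by rewrite leq_pmulr.
have nN : (n <= k * n)%N by rewrite leq_pmull.
have -> : ((8 + 11 * k) * n = 8 * n + 11 * (k * n))%N by ring.
have -> : ((k * n) * (58 + 37 * m) = 58 * (k * n) + (37 * (k * n)) * m)%N.
  by ring.
move: (k * n)%N kN nN => N kN nN.
apply: leq_add; first by lia.
by rewrite leq_mul2r; apply/orP; right; lia.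
Qed.

(** A run unfinished after [t] steps counts as a failure, so the single inequality covers both
    accuracy and time. The two added 1s keep the bound away from 0 when [eps] is large or [delta] is
    near 1. *)
Theorem theorem7 (R : realType) :
  exists (P : seq instr) (c : R), 0 < c /\
  forall (n k : nat) (u p : 'I_n -> R) (r : k.-tuple 'I_n) (eps delta : R),
    (0 < k)%N -> (k <= n)%N -> uniq r ->
    (forall i, 0 < p i <= 1) ->
    0 < eps -> 0 < delta < 1 ->
    forall t : nat,
      c * (1 + (k * n)%:R * (1 + ln (delta^-1)) / (zkp k p * eps ^+ 2)) <= t%:R ->
      1 - delta <=
        succ_prob P (encode u p r) (fun x => `|x - PrPLC u p r| < eps) t
          (init_state n k eps delta).
Proof.
(* With [l = 1 + ln delta^-1] and [l / eps^2 >= 1], one has [58 + 37 m <= 95 + 148 l / eps^2 <= 243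
   l / eps^2]. *)
exists plc_prog, 243; split => // n k u p r eps delta k0 kn r_uniq p01 eps0 d01 t ht.
have /andP[d0 d1] := d01.
have z0 := zkp_gt0 r_uniq p01; have z1 := @zkp_le1 _ _ k _ p01.
set q := fun h : 'I_n => p h * (h \notin [set x in r])%:R.
have q01' h : 0 <= q h <= 1 by apply: q01.
have muE := mean_pl_value u p r_uniq.
have X01 := sample_01 u r_uniq p01.
have w0 C : 0 <= cweight q C by apply: cweight_ge0.
have w1 := sum_cweight q.
have mu01 : 0 <= PrPLC u p r <= 1.
  rewrite -muE; apply/andP; split.
    by apply: sumr_ge0 => C _; rewrite mulr_ge0 //; case/andP: (X01 C).
  rewrite -[X in _ <= X]w1; apply: ler_sum => C _; rewrite ler_piMr //.
  by case/andP: (X01 C).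
have ln0 : 0 <= ln delta^-1 by rewrite ln_ge0 // invf_ge1 // ltW.
have N1 : 1 <= (k * n)%:R :> R by rewrite ler1n muln_gt0 k0 (leq_trans k0 kn).
set Q := (k * n)%:R * _ / _ in ht.
have Q0 : 0 <= Q.
  by rewrite divr_ge0 ?mulr_ge0 ?addr_ge0 ?ler0n ?sqr_ge0 // ltW.
(* For [eps > 1/2] the output 1/2 is within [eps] of any point of [0, 1], and 8 steps are covered by
   the additive 1. *)
have [eps_le|eps_gt] := leP eps (1 / 2); last first.
  have t8 : (8 <= t)%N by rewrite -(ler_nat R); lra.
  have := run_half (encode u p r) (fun x => `|x - PrPLC u p r| < eps) n k delta
    eps_gt t8 (leqnn t).
  apply: le_trans; rewrite /= (_ : `|1 / 2 - PrPLC u p r| < eps).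
    by rewrite gerBl ltW.
  case/andP: mu01 => ? ?; apply: le_lt_trans eps_gt; rewrite ler_norml.
  by apply/andP; split; lra.
have [m [Dlt Dle m_le]] := sample_count eps0 d01.
have m0 : (0 < m)%N.
  by case: m Dlt Dle m_le => // _; rewrite expr0; lra.
have cost : (31 + 8 * k + (8 + 11 * k) * n + (13 + 15 * n + 9 * k) * m <= t)%N.
  have cost1 : (31 + 8 * k + (8 + 11 * k) * n + (13 + 15 * n + 9 * k) * m <=
      (k * n) * (58 + 37 * m))%N.
    by apply: running_time_le => //; apply: leq_trans kn.
  apply: leq_trans cost1 _; rewrite -(ler_nat R); apply: le_trans ht.
  rewrite natrM.
  pose l := 1 + ln delta^-1; have l1 : 1 <= l by rewrite /l lerDl.
  have e2 : 0 < eps ^+ 2 by rewrite exprn_gt0.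
  have e4 : eps ^+ 2 <= 1 by rewrite -(expr1n _ 2) lerXn2r ?nnegrE; lra.
  have le1 : 1 <= l / eps ^+ 2 by rewrite ler_pdivlMr // mul1r (le_trans e4).
  (* The bound [zkp k p <= 1] allows the factor [zkp k p] to enter the denominator. *)
  have QE : (k * n)%:R * (l / eps ^+ 2) <= Q.
    rewrite /Q -/l -mulrA; apply: ler_wpM2l => //.
    apply: ler_wpM2l; first by lra.
    by rewrite lef_pV2 ?posrE ?mulr_gt0 // ler_piMl // ltW.
  apply: (@le_trans _ _ (243 * Q)); last by rewrite mulrDr mulr1 lerDr.
  apply: le_trans (ler_wpM2l _ QE) => //.
  rewrite mulrCA; apply: ler_wpM2l => //.
  rewrite natrD natrM; rewrite -/l -mulrA in m_le.
  lra.
have q01n j : (j < n)%N -> 0 <= flip_prob (encode u p r) k j <= 1.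
  by move=> jn; rewrite -[j]/(val (Ordinal jn)) flip_probE; apply: q01'.
have := run_sampling (fun x => `|x - PrPLC u p r| < eps) q01n Dlt Dle eps_le cost (leqnn t).
apply: le_trans.
apply: le_trans (@sampling_value_ge _ _ _ _ _ _ (PrPLC u p r) _ _ (cweight q)
  (fun C : {set 'I_n} => \sum_(h in C) expR (u h)) _ w0 w1 X01 muE _ m0).
- by rewrite lerD2l lerN2.
- by move=> G; rewrite flip_expectT.
- by rewrite eps0.
Qed.
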